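(* Let $\mathfrak C$ be a left cancellative small category. The following are equivalent: (i) $I_l\ltimes\Omega$ is topologically free; (ii) $\mathfrak C^{*,0}\ltimes\Omega$ is topologically free; (iii) For all $\mathfrak v\in\mathfrak C^0$, $u\in\mathfrak v\mathfrak C^*\mathfrak v$ and $f_1,\dots,f_n\in\mathcal J$ with $f_i\subsetneq\mathfrak v\mathfrak C$ for all $1\le i\le n$: if $uz\in z\mathfrak C^*$ for all $z\in\mathfrak v\mathfrak C\setminus\bigcup_{i=1}^nf_i$, then there exists $x\in\mathfrak v\mathfrak C\setminus\bigcup_{i=1}^nf_i$ with $ux=x$.
   Context: $\mathfrak C$ denotes the set of morphisms, $\mathfrak C^0\subseteq\mathfrak C$ the identity morphisms (identified with objects), $\mathfrak d,\mathfrak t$ domain and target; $cd$ is defined iff $\mathfrak d(c)=\mathfrak t(d)$; left cancellative means $cx=cy\Rightarrow x=y$. For $S\subseteq\mathfrak C$, $cS=\{cs:s\in S,\mathfrak t(s)=\mathfrak d(c)\}$. $\mathfrak C^*$ is the set of invertible elements, $\mathfrak v\mathfrak C^*\mathfrak v$ the set of $u\in\mathfrak C^*$ with $\mathfrak t(u)=\mathfrak d(u)=\mathfrak v$, and $\mathfrak C^{*,0}=\{u\in\mathfrak C^*:\mathfrak t(u)=\mathfrak d(u)\}$. Each $c\in\mathfrak C$ gives the partial bijection $\mathfrak d(c)\mathfrak C\to c\mathfrak C$, $x\mapsto cx$, again denoted $c$; $I_l$ is the smallest semigroup of partial bijections of $\mathfrak C$ containing these and closed under inverses; $\mathcal J=\{\mathrm{dom}(s):s\in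 I_l\}$ is its semilattice of idempotents (product = intersection, order = inclusion). $\widehat{\mathcal J}$ is the space of non-zero multiplicative maps $\chi:\mathcal J\to\{0,1\}$ with $\chi(\emptyset)=0$ if $\emptyset\in\mathcal J$ (pointwise convergence). $\Omega\subseteq\widehat{\mathcal J}$ consists of those $\chi$ such that whenever $e=\bigcup_{i=1}^nf_i$ ($e,f_i\in\mathcal J$) and $\chi(e)=1$, then $\chi(f_i)=1$ for some $i$. $s\in I_l$ acts by $\chi\mapsto s.\chi=\chi(s^{-1}\cdot s)$ from $\Omega(s^{-1}s)=\{\chi\in\Omega:\chi(s^{-1}s)=1\}$ onto $\Omega(ss^{-1})$. $I_l\ltimes\Omega$ is the transformation groupoid: classes $[s,\chi]$ with $s\in I_l$, $\chi\in\Omega(s^{-1}s)$, where $[s,\chi]=[t,\psi]$ iff $\chi=\psi$ and $se=te$ for some $e\in\mathcal J$ with $\chi(e)=1$; source $\chi$, range $s.\chi$, $[s,t.\chi][t,\chi]=[st,\chi]$; topology such that the sets $\{[s,\chi]:\chi\in\Omega(s^{-1}s)\}$ are open and the source map restricts to homeomorphisms from them onto $\Omega(s^{-1}s)$. $\mathfrak C^{*,0}\ltimes\Omega:=\{[u,\chi]\in I_l\ltimes\Omega:u\in\mathfrak C^{*,0}\}$, an open subgroupoid. An étale groupoid $\mathcal G$ (not necessarily Hausdorff) is topologically free if for every open bisection $\gamma\subseteq\mathcal G\setminus\mathcal G^{(0)}$, the set $\{x\in\mathcal G^{(0)}:\mathcal G^x_x\cap\gamma\ne\emptyset\}$ has empty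 interior. *)

(* Defs.v *)
From HB Require Import structures.
From mathcomp Require Import all_boot all_classical.
From mathcomp Require Import topology.

Set Implicit Arguments.
Unset Strict Implicit.
Unset Printing Implicit Defensive.

Local Open Scope classical_set_scope.
Local Open Scope quotient_scope.

Definition elt {T : Type} {A : set T} {x : T} (Ax : A x) : A :=
  exist (fun x => x \in A) x (mem_set Ax).

(* One-sorted small categories: an element of [C] is a morphism and an object
   is identified with its identity morphism.  [cmul c d] stands for the
   composite cd; it is meaningful only when [cdom c = ctgt d]. *)
HB.mixin Record isSmallCategory C := {
  cdom : C -> C;
  ctgt : C -> C;
  cmul : C -> C -> C;
  ctgt_dom : forall c, ctgt (cdom c) = cdom c;
  cdom_tgt : forall c, cdom (ctgt c) = ctgt c;
  cdom_mul : forall c d, cdom c = ctgt d -> cdom (cmul c d) = cdom d;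
  ctgt_mul : forall c d, cdom c = ctgt d -> ctgt (cmul c d) = ctgt c;
  cmul1 : forall c, cmul c (cdom c) = c;
  cmul1l : forall c, cmul (ctgt c) c = c;
  cmulA : forall a b c, cdom a = ctgt b -> cdom b = ctgt c ->
    cmul a (cmul b c) = cmul (cmul a b) c
}.
#[short(type="smallCategoryType")]
HB.structure Definition SmallCategory := {C of isSmallCategory C}.

HB.mixin Record SmallCategory_isLeftCancellative C of SmallCategory C := {
  cmulI : forall c x y : C, cdom c = ctgt x -> cdom c = ctgt y ->
    cmul c x = cmul c y -> x = y
}.
#[short(type="lcCategoryType")]
HB.structure Definition LeftCancellativeCategory :=
  {C of SmallCategory C & SmallCategory_isLeftCancellative C}.

HB.mixin Record SmallCategory_isGroupoid G of SmallCategory G := {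
  cinv : G -> G;
  cdom_inv : forall g, cdom (cinv g) = ctgt g;
  ctgt_inv : forall g, ctgt (cinv g) = cdom g;
  cmulVg : forall g, cmul (cinv g) g = cdom g;
  cmulgV : forall g, cmul g (cinv g) = ctgt g
}.
#[short(type="groupoidType")]
HB.structure Definition Groupoid :=
  {G of SmallCategory G & SmallCategory_isGroupoid G}.

Definition local_homeomorphism (X Y : topologicalType) (f : X -> Y) :=
  forall x, exists U : set X,
    [/\ open U, U x, {within U, continuous f}, {in U &, injective f} &
        forall V, open V -> V `<=` U -> open (f @` V)].

(* Asking that the source map be a local homeomorphism into [G], rather than
   into the subspace of units, amounts to asking in addition that the units
   form an open set, which holds in every etale groupoid. *)
HB.mixin Record isEtale G of Topological G & Groupoid G := {
  cinv_continuous : continuous (cinv : G -> G);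
  cmul_continuous : {within [set p : G * G | cdom p.1 = ctgt p.2],
    continuous (fun p => cmul p.1 p.2)};
  cdom_local_homeomorphism : local_homeomorphism (cdom : G -> G)
}.
#[short(type="etaleGroupoidType")]
HB.structure Definition EtaleGroupoid :=
  {G of Topological G & Groupoid G & isEtale G}.

Section category.
Context {C : smallCategoryType}.

Definition identities : set C := [set v | cdom v = v].

Definition ltranslate (c : C) (S : set C) : set C :=
  [set x | exists2 s, S s & ctgt s = cdom c /\ x = cmul c s].

Definition invertibles : set C := [set u | exists w,
  [/\ cdom u = ctgt w, cdom w = ctgt u, cmul u w = ctgt u & cmul w u = cdom u]].

Definition invertibles0 : set C := [set u | invertibles u /\ ctgt u = cdom u].

Definition invertibles_at (v : C) : set C :=
  [set u | [/\ invertibles u, ctgt u = v & cdom u = v]].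

Lemma cdomK (c : C) : cdom (cdom c) = cdom c.
Proof. by have := cdom_tgt (cdom c); rewrite ctgt_dom. Qed.

Lemma ctgtK (c : C) : ctgt (ctgt c) = ctgt c.
Proof. by have := ctgt_dom (ctgt c); rewrite cdom_tgt. Qed.

End category.
Arguments identities C : clear implicits.
Arguments invertibles C : clear implicits.
Arguments invertibles0 C : clear implicits.

Section topological_freeness.
Context {G : etaleGroupoidType}.

(* As the source and range maps are local homeomorphisms, they restrict to
   homeomorphisms from an open bisection onto open sets. *)
Definition open_bisection (gamma : set G) :=
  [/\ open gamma, {in gamma &, injective cdom} & {in gamma &, injective ctgt}].

Definition isotropy (x : G) : set G := [set g | cdom g = x /\ ctgt g = x].

End topological_freeness.

(* The interior is taken in the unit space: the set is contained in
   [identities G], and [subspace] only isolates points outside of it. *)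
Definition topologically_free (G : etaleGroupoidType) :=
  forall gamma : set G, open_bisection gamma -> gamma `<=` ~` identities G ->
    interior ([set x | identities G x /\ isotropy x `&` gamma !=set0]
              : set (subspace (identities G))) = set0.


(* A partial bijection is represented by its graph.  With the notations of
   [relation_scope], [(s \; t)%relation] is the graph of st, defined by
   (st)(x) = s(t(x)), and [(s^-1)%relation] that of the inverse of s. *)
Section partial_bijections.
Context {T : Type}.
Implicit Types (s t : set (T * T)) (e : set T).

Definition partial_bijection s :=
  (forall x y z, s (x, y) -> s (x, z) -> y = z) /\
  (forall x y z, s (x, z) -> s (y, z) -> x = y).

Definition pdom s : set T := [set x | exists y, s (x, y)].

Definition pid e : set (T * T) := [set p | e p.1 /\ p.1 = p.2].

Definition inverse_semigroup (S : set (set (T * T))) :=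
  [/\ S `<=` partial_bijection,
      forall s t, S s -> S t -> S (s \; t)%relation &
      forall s, S s -> S (s^-1)%relation].

Lemma pcompA (r s t : set (T * T)) :
  ((r \; s) \; t)%relation = (r \; (s \; t))%relation.
Proof.
apply/seteqP; split=> -[x y] /=.
    by move=> [z xz [w zw wy]]; exists w => //; exists z.
by move=> [w [z xz zw] wy]; exists z => //; exists w.
Qed.

End partial_bijections.

Section inverse_hull.
Context {C : lcCategoryType}.

Definition translation (c : C) : set (C * C) :=
  [set p | ctgt p.1 = cdom c /\ p.2 = cmul c p.1].

Definition Il : set (set (C * C)) :=
  smallest inverse_semigroup (range translation).

Definition J : set (set C) := [set pdom s | s in Il].

Lemma inverse_semigroup_pbij :
  inverse_semigroup (@partial_bijection C).
Proof.
split=> //.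
  move=> s t [s1 s2] [t1 t2]; split=> x y z /= [a xa ay] [b xb bz].
    by move: xb => /(t1 _ _ _ xa) ab; subst b; exact: s1 ay bz.
  by move: bz => /(s2 _ _ _ ay) ab; subst b; exact: t2 xa xb.
by move=> s [s1 s2]; split=> x y z /= xy xz; [exact: s2 xy xz|exact: s1 xy xz].
Qed.

Lemma translation_pbij c : partial_bijection (translation c).
Proof.
split=> x y z /=; first by move=> [_ /= ->] [_ /= ->].
by move=> [/= xc ->] [/= yc E]; exact: cmulI E.
Qed.

Lemma Il_inverse_semigroup : inverse_semigroup Il.
Proof.
split.
- apply: smallest_sub; first exact: inverse_semigroup_pbij.
  by move=> _ [c _ <-]; exact: translation_pbij.
- move=> s t ss st S [S1 S2].
  by have [_ Sc _] := S1; apply: Sc; [exact: ss|exact: st].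
- by move=> s ss S [S1 S2]; have [_ _ Si] := S1; apply: Si; exact: ss.
Qed.

Lemma Il_pbij s : Il s -> partial_bijection s.
Proof. by case: Il_inverse_semigroup => h _ _; exact: h. Qed.

Lemma Il_translation c : Il (translation c).
Proof. exact: sub_gen_smallest (imageT translation c). Qed.

Lemma Il_comp s t : Il s -> Il t -> Il (s \; t)%relation.
Proof. by case: Il_inverse_semigroup => _ h _; exact: h. Qed.

Lemma Il_converse s : Il s -> Il (s^-1)%relation.
Proof. by case: Il_inverse_semigroup => _ _ h; exact: h. Qed.

Definition Il_gen (c : C) : Il := elt (Il_translation c).

Definition Il_mul (s t : Il) : Il :=
  elt (Il_comp (set_mem (valP s)) (set_mem (valP t))).

Definition Il_inv (s : Il) : Il := elt (Il_converse (set_mem (valP s))).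

Lemma Il_pid e : J e -> Il (pid e).
Proof.
move=> [s Is <-]; have [_ Ic Ii] := Il_inverse_semigroup.
suff -> : pid (pdom s) = (s^-1 \; s)%relation by apply: Ic => //; exact: Ii.
have [_ s2] := Il_pbij Is.
apply/seteqP; split=> -[x y] /=; first by move=> [[z xz] /= <-]; exists z.
by move=> [z xz yz]; split; [exists z|exact: s2 xz yz].
Qed.

(* The idempotent of [Il] identified with its domain e. *)
Definition Il_idem (e : J) : Il :=
  elt (Il_pid (set_mem (valP e))).

Lemma J_dom_proof (s : Il) : J (pdom (val s)).
Proof. by exists (val s) => //; exact: set_mem (valP s). Qed.

Lemma J_pre_proof (s : Il) (e : J) :
  J [set x | exists2 y, val s (x, y) & val e y].
Proof.
have [t It te] := set_mem (valP e); have [_ Ic _] := Il_inverse_semigroup.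
exists (t \; val s)%relation.
  by apply: Ic => //; exact: set_mem (valP s).
rewrite -te; apply/seteqP; split=> x.
  by move=> [z [y xy yz]]; exists y => //; exists z.
by move=> [y xy [z yz]]; exists z; exists y.
Qed.

Lemma J_cap_proof (e f : J) : J (val e `&` val f).
Proof.
have := J_pre_proof (Il_idem e) f; congr J; apply/seteqP; split=> x /=; first by move=> [y [/= ex <-]].
by move=> [ex fx]; exists x.
Qed.

Definition J_dom (s : Il) : J := elt (J_dom_proof s).

(* The inverse image of e under s, that is, the domain of the idempotent
   s^-1 e s. *)
Definition J_pre (s : Il) (e : J) : J := elt (J_pre_proof s e).

Definition J_cap (e f : J) : J := elt (J_cap_proof e f).

(* [J_cap], i.e. intersection, is the product of the semilattice J. *)
Definition Jhat : set {ptws J -> bool} := [set chi : {ptws J -> bool} |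
  [/\ exists e, chi e,
      forall e f, chi (J_cap e f) = chi e && chi f &
      forall e, val e = set0 -> chi e = false]].

Definition Omega : set {ptws J -> bool} := [set chi : {ptws J -> bool} | Jhat chi /\
  forall (e : J) (n : nat) (f : 'I_n -> J),
    val e = \bigcup_i val (f i) -> chi e -> exists i, chi (f i)].

Definition Omega_at (s : Il) : set Omega := [set chi : Omega | val chi (J_dom s)].

End inverse_hull.
Arguments Il C : clear implicits.
Arguments J C : clear implicits.
Arguments Jhat C : clear implicits.
Arguments Omega C : clear implicits.

Section action.
Context {C : lcCategoryType}.
Implicit Types s t : Il C.

Lemma Omega_mono (chi : Omega C) (e f : J C) :
  val e `<=` val f -> val chi e -> val chi f.
Proof.
move=> ef; have [[_ M _] _] := set_mem (valP chi).
suff {1}-> : e = J_cap e f by rewrite M => /andP[].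
by apply/val_inj; apply/esym/setIidPl.
Qed.

Lemma action_proof s (x : Omega_at s) :
  Omega C (fun e => val (val x) (J_pre s e)).
Proof.
have [[_ M Z] U] := set_mem (valP (val x)).
have [s1 s2] := Il_pbij (set_mem (valP s)).
split; first split.
- exists (J_dom (Il_inv s)); have := set_mem (valP x); apply: Omega_mono.
  by move=> a [b ab]; exists b => //; exists a.
- move=> e f; rewrite -M; congr (val (val x) _).
  apply/val_inj/seteqP; split=> a /=.
    by move=> [b ab [eb fb]]; split; exists b.
  move=> [[b ab eb] [c ac fc]]; exists b => //; split=> //.
  by rewrite (s1 _ _ _ ab ac).
- move=> e e0; apply: Z; apply/seteqP; split=> // a [b _ /=].
  by rewrite e0.
- move=> e n f E; apply: U; apply/seteqP; split=> a /=.
    by rewrite E => -[b ab [i _ fb]]; exists i => //; exists b.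
  by move=> [i _ [b ab fb]]; exists b => //; rewrite E; exists i.
Qed.

(* s.chi = chi(s^-1 . s) *)
Definition action s (x : Omega_at s) : Omega C :=
  elt (action_proof x).

Definition pregerm := {s : Il C & Omega_at s}.

(* The equivalence defining the classes [s, chi]: same character, and se = te
   for some e in J with chi(e) = 1; see also [germ_eq]. *)
Definition germ_rel (p q : pregerm) : bool := `[<
  val (projT2 p) = val (projT2 q) /\
  exists2 e : J C, val (val (projT2 p)) e &
    (val (projT1 p) \; pid (val e))%relation =
    (val (projT1 q) \; pid (val e))%relation >].

Lemma germ_rel_refl : reflexive germ_rel.
Proof.
move=> p; apply/asboolP; split=> //.
by have [[[e ep] _ _] _] := set_mem (valP (val (projT2 p))); exists e.
Qed.

Lemma germ_rel_sym : symmetric germ_rel.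
Proof.
by move=> p q; apply/asboolP/asboolP => -[E [e pe se]]; split=> //;
  exists e => //; rewrite -?E// E.
Qed.

Lemma pid_restr (e f : set C) (s t : set (C * C)) :
  (s \; pid e)%relation = (t \; pid e)%relation -> f `<=` e ->
  (s \; pid f)%relation = (t \; pid f)%relation.
Proof.
move=> E fe; apply/seteqP; split=> -[x y] /= [_ [/= fx <-] xy].
  have : (s \; pid e)%relation (x, y) by exists x => //; split=> //; exact: fe.
  by rewrite E => -[_ [_ /= <-] ?]; exists x.
have : (t \; pid e)%relation (x, y) by exists x => //; split=> //; exact: fe.
by rewrite -E => -[_ [_ /= <-] ?]; exists x.
Qed.

Lemma germ_rel_trans : transitive germ_rel.
Proof.
move=> q p r /asboolP[E [e pe se]] /asboolP[F [f qf sf]]; apply/asboolP.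
split; first by rewrite E.
have [[_ M _] _] := set_mem (valP (val (projT2 p))).
exists (J_cap e f); first by rewrite M pe E qf.
rewrite (pid_restr (f := val (J_cap e f)) se) ?(pid_restr (f := val (J_cap e f)) sf)//.
  exact: subIsetr.
exact: subIsetl.
Qed.

Canonical germ_equiv :=
  EquivRel germ_rel germ_rel_refl germ_rel_sym germ_rel_trans.

End action.
Arguments pregerm C : clear implicits.

(* The topological space underlying the transformation groupoid is the quotient
   of the disjoint union of the spaces [Omega_at s]: by [germ_open_at] and
   [germ_image_open], it makes each set of germs {[s, chi] : chi in Omega_at s}
   open and homeomorphic to [Omega_at s] under the source map. *)
Definition transformation_groupoid (C : lcCategoryType) : Type :=
  quotient_topology {eq_quot @germ_rel C}.

HB.instance Definition _ (C : lcCategoryType) :=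
  Topological.on (transformation_groupoid C).


(* [germ x], for x in [Omega_at s] with underlying character chi, is [s, chi]. *)
Definition germ (C : lcCategoryType) (s : Il C) (x : Omega_at s) :
  transformation_groupoid C :=
  \pi_(transformation_groupoid C) (existT (fun t => Omega_at t) s x).

Section groupoid_structure.
Context {C : lcCategoryType}.
Local Notation G := (transformation_groupoid C).
Implicit Types (s t : Il C) (e : J C) (chi : Omega C).

Lemma germP (g : G) : exists s (x : Omega_at s), g = germ x.
Proof.
by rewrite -[g]reprK; case: (repr g) => s x; exists s; exists x.
Qed.

Lemma germ_eq s t (x : Omega_at s) (y : Omega_at t) :
  germ x = germ y <-> val x = val y /\ exists2 e : J C, val (val x) e &
    (val s \; pid (val e))%relation = (val t \; pid (val e))%relation.
Proof.
split=> [/eqmodP/asboolP//|h]; apply/eqmodP; exact/asboolP.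
Qed.

Lemma germ_eqP s t (x : Omega_at s) (y : Omega_at t) :
  germ x = germ y <-> val x = val y /\ exists2 e : J C, val (val x) e &
    forall a b, val e a -> val s (a, b) <-> val t (a, b).
Proof.
rewrite germ_eq; split=> -[E [e xe st]]; split=> //; exists e => // .
  move=> a b ea; split=> h.
    have : (val s \; pid (val e))%relation (a, b) by exists a.
    by rewrite st => -[_ [_ /= <-]].
  have : (val t \; pid (val e))%relation (a, b) by exists a.
  by rewrite -st => -[_ [_ /= <-]].
apply/seteqP; split=> -[a b] [_ [/= ea <-]] /(st _ _ ea) h; by exists a.
Qed.

(* Source and range as points of [Omega]; [gunit] embeds [Omega] as the set of
   identities, and the domain and target of the category structure below are
   [gunit (gsrc g)] and [gunit (grng g)]. *)
Definition gsrc (g : G) : Omega C := val (projT2 (repr g)).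

Definition grng (g : G) : Omega C := action (projT2 (repr g)).

Lemma repr_germ s (x : Omega_at s) : germ (projT2 (repr (germ x))) = germ x.
Proof. by rewrite -[RHS]reprK; case: (repr _). Qed.

Lemma gsrc_germ s (x : Omega_at s) : gsrc (germ x) = val x.
Proof. by have /germ_eqP[] := repr_germ x. Qed.

Lemma OmegaI chi (e f : J C) : val chi e -> val chi f -> val chi (J_cap e f).
Proof. by have [[_ M _] _] := set_mem (valP chi); rewrite M => -> ->. Qed.

Lemma Omega_eq chi (e f f' : J C) : val chi e ->
  (forall a, val e a -> val f a <-> val f' a) -> val chi f = val chi f'.
Proof.
move=> ce h; apply/idP/idP => cf.
  by apply: Omega_mono (OmegaI ce cf) => a /= [ea] /(h _ ea).
by apply: Omega_mono (OmegaI ce cf) => a /= [ea] /(h _ ea).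
Qed.

Lemma Omega_ext chi chi' : (forall e, val chi e = val chi' e) -> chi = chi'.
Proof. by move=> h; apply/val_inj/funext. Qed.

Lemma action_eq s t (x : Omega_at s) (y : Omega_at t) :
  germ x = germ y -> action x = action y.
Proof.
move=> /germ_eqP[E [e xe st]]; apply: Omega_ext => f /=; rewrite -E.
apply: Omega_eq xe _ => a ea.
by split=> -[b /(st _ _ ea) ab fb]; exists b.
Qed.

Lemma grng_germ s (x : Omega_at s) : grng (germ x) = action x.
Proof. exact: action_eq (repr_germ x). Qed.

Lemma Omega_some chi : exists e, val chi e.
Proof. by have [[]] := set_mem (valP chi). Qed.

Lemma Omega_at_idem e chi : val chi e -> Omega_at (Il_idem e) chi.
Proof.
by apply: Omega_mono => a ea; exists a.
Qed.

Definition Omega_pick chi : J C := sval (cid (Omega_some chi)).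

Lemma Omega_pickP chi : val chi (Omega_pick chi).
Proof. exact: svalP (cid (Omega_some chi)). Qed.

Definition gunit chi : G := germ (elt (Omega_at_idem (Omega_pickP chi))).

(* The identity of G at chi is [e, chi] for any e with chi(e) = 1. *)
Lemma gunitE e chi (h : Omega_at (Il_idem e) chi) : gunit chi = germ (elt h).
Proof.
apply/germ_eqP; split=> //; set f := Omega_pick _; exists (J_cap e f) => /=.
  apply: OmegaI; last exact: Omega_pickP.
  by apply: Omega_mono h => a [b [/= ea _]].
by move=> a b [ea fa]; split=> -[/= _ <-].
Qed.

Lemma gsrc_unit chi : gsrc (gunit chi) = chi.
Proof. by rewrite gsrc_germ. Qed.

Lemma grng_unit chi : grng (gunit chi) = chi.
Proof.
rewrite grng_germ; apply: Omega_ext => f /=; set e := Omega_pick _.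
apply: (@Omega_eq _ e); first exact: Omega_pickP.
move=> a ea; split; first by move=> [b [/= _ <-]].
by exists a.
Qed.

Lemma gunit_eqP s (x : Omega_at s) chi :
  germ x = gunit chi <-> val x = chi /\ exists2 e : J C, val chi e &
    forall a, val e a -> val s (a, a).
Proof.
split.
  move=> /germ_eqP[E]; set f := Omega_pick _ => -[e xe st]; split=> //.
  move: E => /= E; subst chi; exists (J_cap e f).
    by apply: OmegaI => //; exact: Omega_pickP.
  by move=> a [ea fa]; apply/st.
move=> [E [e ce h]]; apply/germ_eqP; split=> //; set f := Omega_pick _.
have cf : val chi f by exact: Omega_pickP.
exists (J_cap e f); first by rewrite E; exact: OmegaI.
have [s1 _] := Il_pbij (set_mem (valP s)).
move=> a b [ea fa]; split; last by move=> [/= _ <-]; exact: h.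
by move=> ab; split => //=; exact: s1 (h _ ea) ab.
Qed.

Lemma Omega_at_mul s t (x : Omega_at s) (y : Omega_at t) :
  val x = action y -> Omega_at (Il_mul s t) (val y).
Proof.
move=> E; have : val (action y) (J_dom s).
  by rewrite -E; exact: set_mem (valP x).
rewrite -[val _ _]/(val (val y) (J_pre t (J_dom s))).
apply: Omega_mono => a [b ab [c bc]].
by exists c; exists b.
Qed.

(* [s, t.chi][t, chi] = [st, chi], see [gmulE]; the value when g and h are not
   composable is irrelevant. *)
Definition gmul (g h : G) : G :=
  match pselect (gsrc g = grng h) with
  | left E => germ (elt (Omega_at_mul E))
  | right _ => g
  end.

Lemma germ_val s (x y : Omega_at s) : val x = val y -> germ x = germ y.
Proof. by move=> /val_inj ->. Qed.

Lemma gmulE s t (x : Omega_at s) (y : Omega_at t) (E : val x = action y) :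
  gmul (germ x) (germ y) = germ (elt (Omega_at_mul E)).
Proof.
rewrite /gmul; case: pselect => [E'|]; last by rewrite gsrc_germ grng_germ.
have /germ_eqP[Ey [f yf Ef]] := repr_germ y.
have /germ_eqP[Ex [e xe Ee]] := repr_germ x.
apply/germ_eqP; split=> //=; exists (J_cap f (J_pre t e)).
  apply: OmegaI => //; rewrite Ey.
  by move: xe; rewrite Ex E.
have [t1 _] := Il_pbij (set_mem (valP t)).
move=> a b [fa [c ac ec]]; split=> -[d ad db].
  have {}ad := (Ef _ _ fa).1 ad; have cd := t1 _ _ _ ac ad; subst d.
  by exists c => //; exact/Ee.
have cd := t1 _ _ _ ac ad; subst d.
by exists c; [exact/Ef|exact/Ee].
Qed.

Lemma Omega_at_inv s (x : Omega_at s) : Omega_at (Il_inv s) (action x).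
Proof.
have := set_mem (valP x); apply: Omega_mono => a [b ab].
by exists b => //; exists a.
Qed.

Definition ginv (g : G) : G := germ (elt (Omega_at_inv (projT2 (repr g)))).

Lemma ginvE s (x : Omega_at s) : ginv (germ x) = germ (elt (Omega_at_inv x)).
Proof.
have E0 := repr_germ x; have E1 := action_eq E0.
have /germ_eqP[E [e xe Ee]] := E0.
apply/germ_eqP; split; first exact: E1.
have [_ s2] := Il_pbij (set_mem (valP s)).
set s' := projT1 (repr _) in Ee *.
have [_ s'2] := Il_pbij (set_mem (valP s')).
exists (J_pre (Il_inv s) (J_cap e (J_dom s))).
  rewrite [X in val X]E1 /=; have := OmegaI xe; rewrite E => /(_ _ (set_mem (valP x))).
  apply: Omega_mono => a [ea [b ab]] /=; exists b => //; exists a => //.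
  by split=> //; exists b.
move=> b a [c cb [ec _]] /=; split=> ab.
  have cb' := (Ee _ _ ec).2 cb.
  by have ca := s'2 _ _ _ cb' ab; subst a.
have ca := s2 _ _ _ cb ab; subst a.
exact/(Ee _ _ ec).
Qed.

Lemma gsrc_mul g h : gsrc g = grng h -> gsrc (gmul g h) = gsrc h.
Proof.
have [s [x ->]] := germP g; have [t [y ->]] := germP h.
by rewrite gsrc_germ grng_germ => E; rewrite gmulE !gsrc_germ.
Qed.

Lemma action_mul s t (x : Omega_at s) (y : Omega_at t) (E : val x = action y) :
  action (elt (Omega_at_mul E)) = action x.
Proof.
apply: Omega_ext => e /=; rewrite E /=; congr (val (val y) _).
apply/val_inj/seteqP; split=> a /=.
  by move=> [b [c ac cb] eb]; exists c => //; exists b.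
by move=> [c ac [b cb eb]]; exists b => //; exists c.
Qed.

Lemma grng_mul g h : gsrc g = grng h -> grng (gmul g h) = grng g.
Proof.
have [s [x ->]] := germP g; have [t [y ->]] := germP h.
by rewrite gsrc_germ grng_germ => E; rewrite gmulE !grng_germ action_mul.
Qed.

Lemma gsrc_inv g : gsrc (ginv g) = grng g.
Proof. by have [s [x ->]] := germP g; rewrite ginvE gsrc_germ grng_germ. Qed.

Lemma action_inv s (x : Omega_at s) :
  action (elt (Omega_at_inv x)) = val x.
Proof.
apply: Omega_ext => e /=; apply: (@Omega_eq _ (J_dom s)).
  exact: set_mem (valP x).
have [_ s2] := Il_pbij (set_mem (valP s)).
move=> a [b ab]; split => /=.
  by move=> [c ac [d /= dc ed]]; rewrite (s2 _ _ _ ac dc).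
by move=> ea; exists b => //; exists a.
Qed.

Lemma grng_inv g : grng (ginv g) = gsrc g.
Proof.
by have [s [x ->]] := germP g; rewrite ginvE gsrc_germ grng_germ action_inv.
Qed.

Let gdom g := gunit (gsrc g).
Let gtgt g := gunit (grng g).

Let gunit_inj chi chi' : gunit chi = gunit chi' -> chi = chi'.
Proof. by move=> /(congr1 gsrc); rewrite !gsrc_unit. Qed.

Let gtgt_dom g : gtgt (gdom g) = gdom g.
Proof. by rewrite /gtgt grng_unit. Qed.

Let gdom_tgt g : gdom (gtgt g) = gtgt g.
Proof. by rewrite /gdom gsrc_unit. Qed.

Let gdom_mul g h : gdom g = gtgt h -> gdom (gmul g h) = gdom h.
Proof. by move=> /gunit_inj E; rewrite /gdom gsrc_mul. Qed.

Let gtgt_mul g h : gdom g = gtgt h -> gtgt (gmul g h) = gtgt g.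
Proof. by move=> /gunit_inj E; rewrite /gtgt grng_mul. Qed.

Let gmul1 g : gmul g (gdom g) = g.
Proof.
rewrite /gdom; have [s [x ->]] := germP g; rewrite gsrc_germ.
have E : val x = action (elt (Omega_at_idem (Omega_pickP (val x)))).
  by rewrite -grng_germ -/(gunit _) grng_unit.
rewrite /gunit gmulE; apply/germ_eqP; split=> //; set f := Omega_pick _.
have xf : val (val x) f by exact: Omega_pickP.
exists f => // a b fa; split; first by move=> [_ [/= _ <-]].
by move=> ab; exists a.
Qed.

Let gmul1l g : gmul (gtgt g) g = g.
Proof.
rewrite /gtgt; have [s [x ->]] := germP g; rewrite grng_germ.
rewrite /gunit gmulE; apply/germ_eqP; split=> //; set f := Omega_pick _.
have xf : val (action x) f. by exact: Omega_pickP.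
exists (J_pre s f) => // a b [c ac fc]; split.
  by move=> [d ad [/= _ <-]].
have [s1 _] := Il_pbij (set_mem (valP s)).
by move=> ab; exists b => //; rewrite -(s1 _ _ _ ac ab).
Qed.

Let gmulA g h k : gdom g = gtgt h -> gdom h = gtgt k ->
  gmul g (gmul h k) = gmul (gmul g h) k.
Proof.
move=> /gunit_inj + /gunit_inj.
have [r [z ->]] := germP k; have [t [y ->]] := germP h.
have [s [x ->]] := germP g; rewrite !gsrc_germ !grng_germ => E F.
have E' : val x = action (elt (Omega_at_mul F)) by rewrite action_mul.
have F' : val (elt (Omega_at_mul E)) = action z by [].
rewrite (gmulE E) (gmulE F) (gmulE E') (gmulE F').
apply/germ_eq; split=> //; have [e ce] := Omega_some (val z); exists e => //.
by rewrite [X in (X \; _)%relation = _](esym (pcompA (val s) (val t) (val r))).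
Qed.

Let gdom_inv g : gdom (ginv g) = gtgt g.
Proof. by rewrite /gdom gsrc_inv. Qed.

Let gtgt_inv g : gtgt (ginv g) = gdom g.
Proof. by rewrite /gtgt grng_inv. Qed.

Let gmulVg g : gmul (ginv g) g = gdom g.
Proof.
rewrite /gdom; have [s [x ->]] := germP g; rewrite gsrc_germ ginvE gmulE.
apply/gunit_eqP; split=> //; exists (J_dom s); first exact: set_mem (valP x).
by move=> a [b ab]; exists b.
Qed.

Let gmulgV g : gmul g (ginv g) = gtgt g.
Proof.
rewrite /gtgt; have [s [x ->]] := germP g; rewrite grng_germ ginvE gmulE.
  by rewrite action_inv.
move=> E; apply/gunit_eqP; split=> //; exists (J_dom (Il_inv s)).
  exact: Omega_at_inv.
by move=> a [b ab]; exists b.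
Qed.

HB.instance Definition _ := isSmallCategory.Build G
  gtgt_dom gdom_tgt gdom_mul gtgt_mul gmul1 gmul1l gmulA.

HB.instance Definition _ := SmallCategory_isGroupoid.Build G
  gdom_inv gtgt_inv gmulVg gmulgV.

End groupoid_structure.

Section etale_structure.
Context {C : lcCategoryType}.
Local Notation G := (transformation_groupoid C).
Implicit Types (s t : Il C) (e : J C) (chi : Omega C).

Lemma open_nbhsP (T : topologicalType) (A : set T) :
  (forall x, A x -> exists2 U, open U & U x /\ U `<=` A) -> open A.
Proof.
move=> h; rewrite openE => x /h [U oU [Ux UA]].
by apply: (@filterS _ _ _ U) => //; exact: open_nbhs_nbhs.
Qed.

Lemma ptws_continuous (X Y : topologicalType) (I : Type) (F : X -> {ptws I -> Y}) :
  (forall i, continuous (F ^~ i)) -> continuous F.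
Proof.
move=> h x; apply/cvg_sup => i U [_ [[V oV <-] Vx] VU].
apply: filterS VU _; apply: (h i x); exact: open_nbhs_nbhs.
Qed.

Lemma ptws_eval_continuous (Y : topologicalType) (I : Type) (i : I) :
  continuous (fun f : {ptws I -> Y} => f i).
Proof.
move=> f U fU; have /cvg_sup/(_ i) : nbhs f --> f by exact: cvg_id.
by apply; exact: (@initial_continuous _ _ (fun h : I -> Y => h i) f U fU).
Qed.

Lemma eval_continuous e : continuous (fun chi : Omega C => val chi e).
Proof.
apply/continuousP => B oB.
have oW := (continuousP _).1 (@ptws_eval_continuous bool _ e) _ oB.
by exists [set f : {ptws J C -> bool} | B (f e)].
Qed.

Lemma open_eval e : open [set chi : Omega C | val chi e].
Proof.
have h := (continuousP _).1 (@eval_continuous e) [set b : bool | b].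
by apply: h; exact: discrete_open.
Qed.

Lemma open_Omega_at s : open (Omega_at s).
Proof. exact: open_eval. Qed.

Lemma open_val_image s (U : set (Omega_at s)) : open U -> open ((val : Omega_at s -> Omega C) @` U).
Proof.
move=> [V oV <-]; suff -> : (val : Omega_at s -> Omega C) @` (val @^-1` V) =
    (V : set (Omega C)) `&` Omega_at s.
  exact: openI oV (open_Omega_at s).
apply/seteqP; split=> [_ [x Vx <-]|chi [Vc sc]].
  by split=> //; exact: set_mem (valP x).
by exists (elt sc).
Qed.

Lemma germ_open (A : set G) :
  open A <-> forall s, open [set x : Omega_at s | A (germ x)].
Proof. exact: sigT_openP. Qed.

Lemma germ_open_at (A : set G) s : open A ->
  open [set chi | exists h : Omega_at s chi, A (germ (elt h))].
Proof.
move=> /germ_open /(_ s) /open_val_image; congr open.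
apply/seteqP; split=> [_ [x Ax <-]|chi [h Ah]]; last by exists (elt h).
exists (set_mem (valP x)); congr A: Ax; exact: germ_val.
Qed.

Lemma germ_image_open (V : set (Omega C)) s : open V ->
  open [set g : G | exists2 x : Omega_at s, V (val x) & g = germ x].
Proof.
move=> oV; apply/germ_open => t; apply: open_nbhsP => y [x Vx].
move=> /germ_eqP[E [e ye st]].
exists (val @^-1` (V `&` Omega_at s `&` [set chi : Omega C | val chi e])).
  by exists (V `&` Omega_at s `&` [set chi : Omega C | val chi e]) => //;
    apply: openI; [apply: openI => //; exact: open_Omega_at|exact: open_eval].
split; first by rewrite /= E; split; [split=> //; exact: set_mem (valP x)|rewrite -E].
move=> z [[Vz sz] ez]; exists (elt sz) => //.
by apply/germ_eqP; split=> //; exists e.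
Qed.

Lemma action_continuous s : continuous (@action C s).
Proof.
apply/continuousP => _ [W oW <-].
pose F (x : Omega_at s) : {ptws J C -> bool} := val (action x).
suff cF : continuous F by exact: (continuousP _).1 cF _ oW.
apply: ptws_continuous => e; apply/continuousP => B oB.
have oV := (continuousP _).1 (@eval_continuous (J_pre s e)) _ oB.
by exists [set chi : Omega C | B (val chi (J_pre s e))].
Qed.

Lemma gsrc_continuous : continuous (@gsrc C).
Proof.
apply/continuousP => V oV; apply/germ_open => s; exists V => //.
by apply/seteqP; split=> x /=; rewrite gsrc_germ.
Qed.

Lemma gsrc_open (U : set G) : open U -> open (@gsrc C @` U).
Proof.
move=> oU; apply: open_nbhsP => _ [g Ug <-]; have [s [x E]] := germP g.
subst g; exists [set chi | exists h : Omega_at s chi, U (germ (elt h))].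
  exact: germ_open_at.
split=> [|chi [h Uh]]; last by exists (germ (elt h)) => //; rewrite gsrc_germ.
rewrite gsrc_germ; exists (set_mem (valP x)); congr U: Ug; exact: germ_val.
Qed.

Lemma gunit_continuous : continuous (@gunit C).
Proof.
apply/continuousP => A oA; apply: open_nbhsP => chi Ac.
have [e ce] := Omega_some chi; have h := Omega_at_idem ce.
exists [set chi' | exists h : Omega_at (Il_idem e) chi', A (germ (elt h))].
  exact: germ_open_at.
split; first by exists h; rewrite -gunitE.
by move=> chi' [h']; rewrite -gunitE.
Qed.

Lemma gunit_open (V : set (Omega C)) : open V -> open (@gunit C @` V).
Proof.
move=> oV; apply: open_nbhsP => _ [chi Vc <-].
have [e ce] := Omega_some chi; have h := Omega_at_idem ce.
exists [set g : G | exists2 x : Omega_at (Il_idem e), V (val x) & g = germ x].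
  exact: germ_image_open.
split; first by exists (elt h) => //; exact: gunitE.
move=> _ [x Vx ->]; exists (val x) => //.
by rewrite (gunitE (set_mem (valP x))); exact: germ_val.
Qed.

Lemma germ_cdom (g : G) : cdom g = gunit (gsrc g). Proof. by []. Qed.
Lemma germ_ctgt (g : G) : ctgt g = gunit (grng g). Proof. by []. Qed.
Lemma germ_cmul (g h : G) : cmul g h = gmul g h. Proof. by []. Qed.
Lemma germ_cinv (g : G) : cinv g = ginv g. Proof. by []. Qed.

Lemma gunit_inj : injective (@gunit C).
Proof. by move=> chi chi' /(congr1 (@gsrc C)); rewrite !gsrc_unit. Qed.

Let ginv_continuous : continuous (cinv : G -> G).
Proof.
apply/continuousP => A oA; apply/germ_open => s.
have [V oV VE] := (germ_open A).1 oA (Il_inv s).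
have : open (@action C s @^-1` V) by move/continuousP: (@action_continuous s); exact.
congr open; apply/seteqP; split=> x.
  move=> Vx; have : (val @^-1` V) (elt (Omega_at_inv x)) by [].
  by rewrite VE /= germ_cinv ginvE.
rewrite /= germ_cinv ginvE => Ax.
by have : (val @^-1` V) (elt (Omega_at_inv x)) by rewrite VE.
Qed.

Let gmul_continuous : {within [set p : G * G | cdom p.1 = ctgt p.2],
  continuous (fun p => cmul p.1 p.2)}.
Proof.
apply/subspace_continuousP => -[g h] /= /gunit_inj.
have [s [x ->]] := germP g; have [t [y ->]] := germP h.
rewrite gsrc_germ grng_germ => E N; rewrite nbhsE.
move=> [A [oA Axy] AN].
have {}Axy : A (gmul (germ x) (germ y)) by [].
rewrite gmulE in Axy.
pose W := [set chi | exists h : Omega_at (Il_mul s t) chi, A (germ (elt h))].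
exists ([set g : G | exists2 x : Omega_at s, setT (val x) & g = germ x],
        [set g : G | exists2 x : Omega_at t, W (val x) & g = germ x]).
  split; apply: open_nbhs_nbhs.
    by split; [apply: germ_image_open; exact: openT|exists x].
  split; first by apply: germ_image_open; exact: germ_open_at.
  by exists y => //; exists (Omega_at_mul E).
move=> [_ _] [/= [x' _ ->] [y' [k Ak] ->]] /= /gunit_inj.
rewrite gsrc_germ grng_germ => E'; apply: AN.
suff : A (gmul (germ x') (germ y')) by [].
by rewrite gmulE; congr A: Ak; exact: germ_val.
Qed.

Let gdom_local_homeomorphism : local_homeomorphism (cdom : G -> G).
Proof.
move=> g; have [s [x ->]] := germP g.
exists [set g : G | exists2 x : Omega_at s, setT (val x) & g = germ x]; split.
- by apply: germ_image_open; exact: openT.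
- by exists x.
- apply: continuous_subspaceT => z.
  exact: continuous_comp (@gsrc_continuous z) (@gunit_continuous (gsrc z)).
- move=> g1 g2 /set_mem[x1 _ ->] /set_mem[x2 _ ->] /gunit_inj.
  by rewrite !gsrc_germ; exact: germ_val.
- move=> V oV _; rewrite (_ : cdom @` V = @gunit C @` (@gsrc C @` V)).
    by apply: gunit_open; exact: gsrc_open.
  by rewrite image_comp.
Qed.

HB.instance Definition _ := isEtale.Build G
  ginv_continuous gmul_continuous gdom_local_homeomorphism.

End etale_structure.

Section open_subgroupoid.
Context {G : etaleGroupoidType}.

Lemma cdom_continuous : continuous (cdom : G -> G).
Proof.
move=> x; have [U [oU Ux cU _ _]] := cdom_local_homeomorphism x.
by move: cU; rewrite (continuous_open_subspace _ oU); apply; exact: mem_set.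
Qed.

Record openSubgroupoid := OpenSubgroupoid {
  osg_set : set G;
  osg_open : open osg_set;
  osg_inv : forall g, osg_set g -> osg_set (cinv g);
  osg_mul : forall g h, osg_set g -> osg_set h -> cdom g = ctgt h ->
    osg_set (cmul g h)
}.

Definition subgroupoid_type (H : openSubgroupoid) : Type := set_type (osg_set H).

HB.instance Definition _ (H : openSubgroupoid) :=
  Topological.copy (subgroupoid_type H) (set_type (osg_set H)).

Context (H : openSubgroupoid).
Local Notation S := (subgroupoid_type H).

Lemma osg_dom g : osg_set H g -> osg_set H (cdom g).
Proof.
by move=> Hg; rewrite -cmulVg; apply: osg_mul => //; [exact: osg_inv|exact: cdom_inv].
Qed.

Lemma osg_tgt g : osg_set H g -> osg_set H (ctgt g).
Proof. by move=> Hg; rewrite -cdom_inv; apply: osg_dom; exact: osg_inv. Qed.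

Let v (x : S) : G := val x.

Let vP (x : S) : osg_set H (v x). Proof. exact: set_mem (valP x). Qed.

Definition osg_elt g (Hg : osg_set H g) : S := elt Hg.

Let sdom (x : S) : S := osg_elt (osg_dom (vP x)).
Let stgt (x : S) : S := osg_elt (osg_tgt (vP x)).
Let sinv (x : S) : S := osg_elt (osg_inv (vP x)).
Let smul (x y : S) : S := match pselect (cdom (v x) = ctgt (v y)) with
  | left E => osg_elt (osg_mul (vP x) (vP y) E)
  | right _ => x
  end.

Let v_inj : injective v. Proof. exact: val_inj. Qed.

Let sdomE x y : sdom x = stgt y -> cdom (v x) = ctgt (v y).
Proof. by move=> /(congr1 v). Qed.

Let smulE x y : cdom (v x) = ctgt (v y) -> v (smul x y) = cmul (v x) (v y).
Proof. by rewrite /smul; case: pselect. Qed.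

Let stgt_dom x : stgt (sdom x) = sdom x.
Proof. by apply: v_inj; exact: ctgt_dom. Qed.

Let sdom_tgt x : sdom (stgt x) = stgt x.
Proof. by apply: v_inj; exact: cdom_tgt. Qed.

Let sdom_mul x y : sdom x = stgt y -> sdom (smul x y) = sdom y.
Proof.
move=> /sdomE E; apply: v_inj; rewrite -[LHS]/(cdom (v (smul x y))) smulE//.
exact: cdom_mul.
Qed.

Let stgt_mul x y : sdom x = stgt y -> stgt (smul x y) = stgt x.
Proof.
move=> /sdomE E; apply: v_inj; rewrite -[LHS]/(ctgt (v (smul x y))) smulE//.
exact: ctgt_mul.
Qed.

Let smul1 x : smul x (sdom x) = x.
Proof.
apply: v_inj; rewrite smulE; first exact: cmul1.
by rewrite -[RHS]/(ctgt (cdom (v x))) ctgt_dom.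
Qed.

Let smul1l x : smul (stgt x) x = x.
Proof.
apply: v_inj; rewrite smulE; first exact: cmul1l.
by rewrite -[LHS]/(cdom (ctgt (v x))) cdom_tgt.
Qed.

Let smulA x y z : sdom x = stgt y -> sdom y = stgt z ->
  smul x (smul y z) = smul (smul x y) z.
Proof.
move=> /sdomE E /sdomE F; apply: v_inj.
by rewrite !smulE ?cmulA// ?cdom_mul ?ctgt_mul.
Qed.

Let sdom_inv x : sdom (sinv x) = stgt x.
Proof. by apply: v_inj; exact: cdom_inv. Qed.

Let stgt_inv x : stgt (sinv x) = sdom x.
Proof. by apply: v_inj; exact: ctgt_inv. Qed.

Let smulVg x : smul (sinv x) x = sdom x.
Proof.
by apply: v_inj; rewrite smulE; [exact: cmulVg|exact: cdom_inv].
Qed.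

Let smulgV x : smul x (sinv x) = stgt x.
Proof.
by apply: v_inj; rewrite smulE; [exact: cmulgV|exact/esym/ctgt_inv].
Qed.

HB.instance Definition _ := isSmallCategory.Build S
  stgt_dom sdom_tgt sdom_mul stgt_mul smul1 smul1l smulA.

HB.instance Definition _ := SmallCategory_isGroupoid.Build S
  sdom_inv stgt_inv smulVg smulgV.

Let v_continuous : continuous v.
Proof. exact: initial_continuous. Qed.

Let sinv_continuous : continuous (cinv : S -> S).
Proof.
apply/continuousP => _ [V oV <-].
have oV' := (continuousP _).1 (@cinv_continuous G) _ oV.
by exists (cinv @^-1` V).
Qed.

Let smul_continuous : {within [set p : S * S | cdom p.1 = ctgt p.2],
  continuous (fun p => cmul p.1 p.2)}.
Proof.
apply/subspace_continuousP => -[x y] /= /sdomE E N.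
rewrite nbhsE => -[_ [[V oV <-] Vxy] VN].
have {}Vxy : V (v (smul x y)) by [].
rewrite smulE// in Vxy.
have /subspace_continuousP/(_ (v x, v y) E) := @cmul_continuous G.
move=> /(_ V (open_nbhs_nbhs (conj oV Vxy))) [[P Q] /= [Px Qy] PQ].
exists (v @^-1` P, v @^-1` Q).
  by split; apply: v_continuous.
move=> [x' y'] [/= Px' Qy'] /sdomE E'; apply: VN.
suff : V (v (smul x' y')) by [].
rewrite smulE//; exact: (PQ (v x', v y')).
Qed.

Let sdom_local_homeomorphism : local_homeomorphism (cdom : S -> S).
Proof.
move=> x; have [U [oU Ux _ iU hU]] := cdom_local_homeomorphism (v x).
exists (v @^-1` U); split=> //.
- by exists U.
- apply: continuous_subspaceT; apply/continuousP => _ [V oV <-].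
  have oV' := (continuousP _).1 (cdom_continuous) _ oV.
  by exists (cdom @^-1` V).
- move=> y z /set_mem Uy /set_mem Uz /(congr1 v) yz; apply: v_inj.
  by apply: iU => //; exact: mem_set.
- move=> W [V oV VE] WU.
  have sub : V `&` osg_set H `<=` U.
    by move=> g [Vg Hg]; apply: (WU (osg_elt Hg)); rewrite -VE.
  exists (cdom @` (V `&` osg_set H)); first by apply: hU => //; exact: openI (osg_open H).
  apply/seteqP; split=> y.
    move=> [g [Vg Hg] gy]; exists (osg_elt Hg); first by rewrite -VE.
    by apply: v_inj; rewrite -[RHS]gy.
  move=> [z Wz <-]; exists (v z) => //; split=> //.
  by move: Wz; rewrite -VE.
Qed.

HB.instance Definition _ := isEtale.Build S
  sinv_continuous smul_continuous sdom_local_homeomorphism.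

End open_subgroupoid.
Arguments openSubgroupoid G : clear implicits.

Section isotropy_subgroupoid.
Context {C : lcCategoryType}.
Local Notation G := (transformation_groupoid C).

(* The germs [u, chi] with u invertible and ctgt u = cdom u. *)
Definition invertible_germs : set G := [set g | exists2 u, invertibles0 C u &
  exists x : Omega_at (Il_gen u), g = germ x].

Let open_germs : open invertible_germs.
Proof.
apply: open_nbhsP => _ [u u0 [x ->]].
exists [set g | exists2 x : Omega_at (Il_gen u), setT (val x) & g = germ x].
  by apply: germ_image_open; exact: openT.
by split=> [|_ [y _ ->]]; [exists x|exists u => //; exists y].
Qed.

Let inv_germs g : invertible_germs g -> invertible_germs (cinv g).
Proof.
move=> [u [[w [uw wu uwE wuE]] tu] [x ->]].
have E : val (Il_inv (Il_gen u)) = translation w.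
  apply/seteqP; split=> -[b a] [/= h ->]; split=> /=.
  - by rewrite ctgt_mul// wu.
  - by rewrite cmulA// ?wuE -?h ?cmul1l// -uw.
  - by rewrite ctgt_mul// ?uw// h.
  - by rewrite cmulA// ?h// uwE -wu -h cmul1l.
have h : Omega_at (Il_gen w) (action x).
  by rewrite (_ : Il_gen w = Il_inv (Il_gen u));
    [exact: Omega_at_inv|exact/val_inj/esym].
exists w.
  split; last by rewrite -uw wu tu.
  by exists u; split=> //; rewrite ?uwE ?wuE.
exists (elt h); rewrite germ_cinv ginvE; apply/germ_eqP; split=> //.
have [e xe] := Omega_some (action x); exists e => // a b _.
by rewrite E.
Qed.

Let mul_germs g h : invertible_germs g -> invertible_germs h ->
  cdom g = ctgt h -> invertible_germs (cmul g h).
Proof.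
move=> [u [[w [uw wu uwE wuE]] tu] [x ->]].
move=> [u' [[w' [uw' wu' uwE' wuE']] tu'] [y ->]].
move=> /gunit_inj; rewrite gsrc_germ grng_germ => E.
have uu' : cdom u = ctgt u'.
  have [[_ _ Z] _] := set_mem (valP (val x)).
  have xu : val (val x) (J_dom (Il_gen u)) by exact: set_mem (valP x).
  have xu' : val (val x) (J_dom (Il_inv (Il_gen u'))).
    by rewrite E; exact: Omega_at_inv.
  apply: contrapT => n; have := OmegaI xu xu'; rewrite Z//.
  apply/seteqP; split=> // a [[b [/= au _]] [c [/= cu' ac]]].
  by apply: n; rewrite -au ac ctgt_mul.
have M : translation (cmul u u') = (translation u \; translation u')%relation.
  apply/seteqP; split=> -[a b].
    move=> [/=]; rewrite cdom_mul// => au' ->.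
    exists (cmul u' a); first by split.
    by split => /=; rewrite ?ctgt_mul ?cmulA.
  move=> [c [/= au' ->] [/= _ ->]]; split; rewrite /= ?cdom_mul//.
  by rewrite cmulA.
exists (cmul u u').
  split; last by rewrite ctgt_mul// cdom_mul// -tu' -uu'.
  exists (cmul w' w); have w'w : cdom w' = ctgt w by rewrite wu' -uw.
  rewrite !cdom_mul// !ctgt_mul//; split=> //.
  - rewrite -cmulA//; last by rewrite ctgt_mul.
    by rewrite (@cmulA _ u' w' w)// uwE' -uu' uw cmul1l.
  - rewrite -cmulA// ?ctgt_mul//.
    by rewrite (@cmulA _ w u u')// wuE uu' cmul1l.
have k : Omega_at (Il_gen (cmul u u')) (val y).
  by rewrite (_ : Il_gen _ = Il_mul (Il_gen u) (Il_gen u'));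
    [exact: Omega_at_mul E|exact/val_inj].
exists (elt k); rewrite germ_cmul gmulE; apply/germ_eqP; split=> //.
by have [e ye] := Omega_some (val y); exists e => // a b _; rewrite /= M.
Qed.

Definition invertible_subgroupoid : openSubgroupoid G :=
  OpenSubgroupoid open_germs inv_germs mul_germs.

End isotropy_subgroupoid.
Arguments invertible_subgroupoid C : clear implicits.

(* Main.v *)
Require Import Defs.
From mathcomp Require Import all_boot all_classical topology.

Set Implicit Arguments.
Unset Strict Implicit.
Unset Printing Implicit Defensive.

Local Open Scope classical_set_scope.

(* The principal characters chi_x, with chi_x(e) = 1 iff x lies in e, are dense
   in Omega, satisfy s.chi_x = chi_(s(x)), and chi_x = chi_y iff y lies in x C^*.
   Topological freeness passes to open subgroupoids.  If u violates the algebraic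
   condition for v and the f_i, then the germs [u, chi] with chi(vC) = 1 and
   chi(f_i) = 0 form an open bisection of non-trivial isotropy germs over the
   non-empty open set of all these chi.  Conversely, if [s, chi] is isotropy for
   all chi in a basic open set given by e and f_i, pick x in e outside of the f_i:
   then s(x) = xu with u invertible, and s(xz) = xuz.  So the algebraic condition
   applies to u and the sets x^-1 f_i, and a fixed point uz = z makes s the
   identity on xzC, i.e. [s, chi_(xz)] a unit. *)

(** * Topological freeness and open subgroupoids of etale groupoids *)

Section etale_groupoid.
Context {G : etaleGroupoidType}.

(** [cdom] maps small open neighbourhoods onto open sets of units. *)
Lemma open_identities : open (identities G).
Proof.
apply: open_nbhsP => x xx; have [U [oU Ux _ _ hU]] := cdom_local_homeomorphism x.
exists (cdom @` U); first exact: hU.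
by split=> [|_ [y _ <-]]; [exists x|exact: cdomK].
Qed.

(** Units form an open set, so interiors relative to the unit space are open in [G]. *)
Lemma topologically_freeP : topologically_free G <->
  forall gamma U : set G, open_bisection gamma -> gamma `<=` ~` identities G ->
    open U -> U `<=` [set x | identities G x /\ isotropy x `&` gamma !=set0] ->
    U = set0.
Proof.
split=> free gamma.
  move=> U bg gI oU US; rewrite -subset0 -(free gamma bg gI) => x Ux.
  have oU' : open (U : set (subspace (identities G))) by exact: open_subspaceW.
  by rewrite /interior nbhsE; exists U.
move=> bg gI; set S := (X in interior X).
pose V : set G := interior (S : set (subspace (identities G))).
have VS : V `<=` S by exact: (@interior_subset (subspace (identities G))).
rewrite -[LHS]/V; apply: (free gamma V) => //.
have := @open_interior (subspace (identities G)) S.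
by rewrite -(open_setIS _ open_identities) setIidl// => y /VS[].
Qed.

End etale_groupoid.

(** The inclusion into [G] preserves open sets, bisections, units and isotropy, so test sets [gamma]
    and [U] in the subgroupoid are test sets in [G]. *)
Lemma topologically_free_open_subgroupoid (G : etaleGroupoidType)
    (H : openSubgroupoid G) :
  topologically_free G -> topologically_free (subgroupoid_type H).
Proof.
move=> /topologically_freeP free; apply/topologically_freeP => gamma U.
pose v : subgroupoid_type H -> G := val.
have openv W : open W -> open (v @` W).
  move=> [V oV <-]; rewrite (_ : v @` _ = V `&` osg_set H).
    exact: openI oV (osg_open H).
  apply/seteqP; split=> [_ [x Vx <-]|x [Vx Hx]]; last by exists (osg_elt Hx).
  by split=> //; exact: set_mem (valP x).
move=> [og dg tg] gI oU US; suff : v @` U = set0.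
  by move=> U0; rewrite -subset0 => x Ux; have : (v @` U) (v x); [exists x|rewrite U0].
apply: (free (v @` gamma)); last 2 first.
- exact: openv.
- move=> _ [x /US[xI [g [[gs gt] gg]]] <-]; split; first exact: (congr1 v xI).
  by exists (v g); split; [split; [exact: (congr1 v gs)|exact: (congr1 v gt)]|exists g].
- split; first exact: openv.
    move=> _ _ /set_mem[x gx <-] /set_mem[y gy <-] E; congr v.
    by apply: dg; [exact: mem_set|exact: mem_set|exact: val_inj].
  move=> _ _ /set_mem[x gx <-] /set_mem[y gy <-] E; congr v.
  by apply: tg; [exact: mem_set|exact: mem_set|exact: val_inj].
- by move=> _ [x gx <-] E; apply: (gI x) => //; exact: val_inj.
Qed.

(** * Right equivariance of [Il] and principal characters *)

Section characters.
Context {C : lcCategoryType}.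
Implicit Types (e : J C) (r : seq (J C)) (s : Il C).

(** The partial bijections with this equivariance form an inverse semigroup containing all
    translations, and [Il] is the smallest one. *)
Lemma Il_rmul (s : set (C * C)) x y : Il C s -> s (x, y) ->
  cdom y = cdom x /\ forall z, ctgt z = cdom x -> s (cmul x z, cmul y z).
Proof.
pose S := [set s : set (C * C) | partial_bijection s /\
  forall x y, s (x, y) ->
    cdom y = cdom x /\ forall z, ctgt z = cdom x -> s (cmul x z, cmul y z)].
move=> Is; suff [_] : S s by apply.
apply: Is; split; first split.
- by move=> t [].
- move=> s1 s2 [p1 h1] [p2 h2]; split.
    by have [_ c _] := @inverse_semigroup_pbij C; exact: c.
  move=> a b [c /h2[dc ac] /h1[db cb]]; split; first by rewrite db.
  move=> z za; exists (cmul c z); first exact: ac.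
  by apply: cb; rewrite dc.
- move=> t [p h]; split.
    by have [_ _ i] := @inverse_semigroup_pbij C; exact: i.
  by move=> a b /h [d m]; split=> // z; rewrite d; exact: m.
- move=> _ [c _ <-]; split; first exact: translation_pbij.
  move=> a b [/= ac ->]; split; first by rewrite cdom_mul.
  by move=> z za; split=> /=; rewrite ?ctgt_mul ?cmulA.
Qed.

Lemma J_rmul (e : set C) x z : J C e -> e x -> ctgt z = cdom x -> e (cmul x z).
Proof.
move=> [s Is <-] [y sxy] zx; have [_ h] := Il_rmul Is sxy.
by exists (cmul y z); exact: h.
Qed.

Lemma Il_fun s x y z : val s (x, y) -> val s (x, z) -> y = z.
Proof. by have [s1 _] := Il_pbij (set_mem (valP s)); exact: s1. Qed.

Lemma principal_proof (x : C) : Omega C (fun e => `[< val e x >]).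
Proof.
split; first split.
- by exists (J_dom (Il_gen (ctgt x))); apply/asboolP; exists (cmul (ctgt x) x);
    split=> //=; rewrite cdom_tgt.
- by move=> e f; apply/asboolP/andP => [[ex fx]|[/asboolP ex /asboolP fx]];
    [split; apply/asboolP|split].
- by move=> e e0; apply/asboolP; rewrite e0.
- move=> e n f E /asboolP; rewrite E => -[i _ fx].
  by exists i; apply/asboolP.
Qed.

Definition principal (x : C) : Omega C := elt (principal_proof x).

Lemma principalE x e : val (principal x) e <-> val e x.
Proof. by split=> /asboolP. Qed.

(** This is s.chi_x = chi_(s(x)), tested on [e]; the equation on [val chi] leaves the proof
    component of [chi] arbitrary. *)
Lemma action_principal s (chi : Omega_at s) x y e :
  val chi = principal x -> val s (x, y) -> val (action chi) e <-> val e y.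
Proof.
move=> E xy; rewrite -[val (action chi) e]/(val (val chi) (J_pre s e)) E.
rewrite principalE; split=> [[z xz ez]|ey]; last by exists y.
by rewrite (Il_fun xy xz).
Qed.

(** * Basic open sets of [Omega] and density of principal characters *)

Definition cylinder e r : set (Omega C) :=
  [set chi | val chi e && all (fun f => ~~ val chi f) r].

Lemma cylinder_open e r : open (cylinder e r).
Proof.
rewrite (_ : cylinder e r = [set chi : Omega C | val chi e] `&`
  [set chi : Omega C | all (fun f => ~~ val chi f) r]); last first.
  by apply/seteqP; split=> chi /=; [move=> /andP|move=> [h1 h2]; apply/andP].
apply: openI; first exact: open_eval.
elim: r => [|f r IH].
  rewrite [X in open X](_ : _ = [set: Omega C]); first exact: openT.
  by apply/seteqP; split.
rewrite [X in open X](_ : _ = [set chi : Omega C | ~~ val chi f] `&`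
  [set chi : Omega C | all (fun f => ~~ val chi f) r]); last first.
  by apply/seteqP; split=> chi /=; [move=> /andP|move=> [h1 h2]; apply/andP].
apply: openI => //.
have h := (continuousP _).1 (@Defs.eval_continuous C f) [set b : bool | ~~ b].
by apply: h; exact: discrete_open.
Qed.

(** The cylinders around [chi] generate a filter converging pointwise to [chi], so it contains the
    open set [W]. *)
Lemma cylinder_base (V : set (Omega C)) chi : open V -> V chi ->
  exists e r, cylinder e r chi /\ cylinder e r `<=` V.
Proof.
move=> [W oW <-] Wchi.
pose cyl e r := [set psi : {ptws J C -> bool} | psi e && all (fun f => ~~ psi f) r].
(* Restricting to [Jhat C] lets two cylinders be merged into one by multiplicativity. *)
pose F : set_system {ptws J C -> bool} := [set A | exists e r,
  cyl e r (val chi) /\ Jhat C `&` cyl e r `<=` A].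
have FF : Filter F.
  split.
  - by have [e ce] := Omega_some chi; exists e, [::]; rewrite /cyl /= ce.
  - move=> A B [e [r [ce eA]]] [e' [r' [ce' eB]]].
    exists (J_cap e e'), (r ++ r'); split.
      move: ce ce' => /andP[ce cr] /andP[ce' cr'].
      by rewrite /cyl /= all_cat cr cr' OmegaI.
    move=> psi [Jpsi]; rewrite /cyl /= all_cat.
    have [_ M _] := Jpsi; rewrite M => /andP[/andP[pe pe'] /andP[pr pr']].
    by split; [apply: eA|apply: eB]; split=> //; apply/andP.
  - by move=> A B AB [e [r [ce eA]]]; exists e, r; split=> // psi /eA/AB.
have cF : F --> (val chi : {ptws J C -> bool}).
  apply/cvg_sup => i A [_ [[B oB <-] Bi] BA]; apply: filterS BA _.
  case ci: (val chi i) Bi => Bi.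
    by exists i, [::]; rewrite /cyl /= ci; split=> // psi [_ /andP[pi _]] /=;
      rewrite /= pi -?ci.
  (* When chi(i) = 0, [i] becomes the excluded set and any [e] with value 1 serves. *)
  have [e ce] := Omega_some chi.
  exists e, [:: i]; rewrite /cyl /= ce ci; split=> // psi [_ /andP[_ /andP[/negbTE pi _]]].
  by rewrite /= pi -?ci.
have [e [r [ce eW]]] : F W by apply: cF; exact: open_nbhs_nbhs.
exists e, r; split=> // psi pe; apply: eW; split=> //.
by have [] := set_mem (valP psi).
Qed.

Lemma cylinderP e r chi : cylinder e r chi <->
  val chi e /\ forall i, ~ val chi (tnth (in_tuple r) i).
Proof.
have P := @all_tnthP _ _ (fun f => ~~ val chi f) (in_tuple r).
split=> [/andP[ce /P h]|[ce h]]; first by split=> // i; apply/negP.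
by apply/andP; split=> //; apply/P => i; apply/negP.
Qed.

Lemma cylinder_principal e r x : cylinder e r (principal x) <->
  val e x /\ forall i, ~ val (tnth (in_tuple r) i) x.
Proof.
rewrite cylinderP principalE; split=> -[ex h]; split=> // i; move: (h i);
  by rewrite principalE.
Qed.

(** Otherwise [e] is the union of its intersections with the members of [r], and the union condition
    defining [Omega] yields a member of [r] with value 1. *)
Lemma principal_dense e r chi : cylinder e r chi ->
  exists x, cylinder e r (principal x).
Proof.
move=> /cylinderP[ce cr]; have [_ U] := set_mem (valP chi).
apply: contrapT => h.
have [|i ci] := U e (size r) (fun i => J_cap e (tnth (in_tuple r) i)) _ ce.
  apply/seteqP; split=> [x ex|x [i _ []]//].
  apply: contrapT => n; apply: h; exists x; apply/cylinder_principal; split=> //.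
  by move=> i fx; apply: n; exists i.
by apply: (cr i); apply: Omega_mono ci; exact: subIsetr.
Qed.

Lemma Omega_cap (chi : Omega C) e f :
  val chi (J_cap e f) = val chi e && val chi f.
Proof. by have [[_ M _] _] := set_mem (valP chi); exact: M. Qed.

(** An equality of propositions, to serve as a rewriting rule. *)
Lemma cylinder_cap e f r chi : cylinder (J_cap e f) r chi =
  (val chi e && val chi f && all (fun k => ~~ val chi k) r) :> Prop.
Proof. by rewrite -Omega_cap. Qed.

(** * Principal right ideals aC and equality of principal characters *)

Lemma ltranslate_identity (v : C) : identities C v ->
  ltranslate v setT = [set z | ctgt z = v].
Proof.
move=> vI; apply/seteqP; split=> [_ [z _ [zv ->]]|z zv] /=.
  by rewrite vI in zv; rewrite -zv cmul1l.
by exists z => //; rewrite vI; split=> //; rewrite -zv cmul1l.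
Qed.

(** b = au and a = bw give auw = a and bwu = b; cancelling on the left makes u and w mutually
    inverse. *)
Lemma invertible_of_mutual_ideals (a b : C) :
  ltranslate a setT b -> ltranslate b setT a -> ltranslate a (invertibles C) b.
Proof.
move=> [u _ [ua bE]] [w _ [wb aE]]; exists u => //.
have cb : cdom b = cdom u by rewrite bE cdom_mul.
have ca : cdom a = cdom w by rewrite aE cdom_mul.
have uw : cdom u = ctgt w by rewrite -cb.
have wu : cdom w = ctgt u by rewrite -ca.
exists w; split=> //.
  apply: (@cmulI _ a); rewrite ?ctgtK ?ctgt_mul//.
  by rewrite cmulA// -bE -aE ua cmul1.
apply: (@cmulI _ b); rewrite ?ctgt_mul ?ctgt_dom//.
by rewrite cmulA// -aE -bE -cb cmul1.
Qed.

(** The ideal aC, the least member of [J] containing [a]. *)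
Definition J_ideal (a : C) : J C := J_dom (Il_inv (Il_gen a)).

Lemma J_idealE a : val (J_ideal a) = ltranslate a setT.
Proof.
apply/seteqP; split=> [b [z [/= za ->]]|b [z _ [za ->]]]; first by exists z.
by exists z.
Qed.

Lemma mem_J_ideal a : val (J_ideal a) a.
Proof. by rewrite J_idealE; exists (cdom a) => //; rewrite ctgt_dom cmul1. Qed.

(** chi_a has value 1 at aC, so equality puts b in aC and a in bC; conversely, members of [J] are
    closed under right multiplication. *)
Lemma principal_eqP (a b : C) :
  principal a = principal b <-> ltranslate a (invertibles C) b.
Proof.
split=> [E|[u [w [uw wu uwE _]] [ua bE]]].
  apply: invertible_of_mutual_ideals; rewrite -J_idealE; apply/principalE.
    by rewrite -E; apply/principalE; exact: mem_J_ideal.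
  by rewrite E; apply/principalE; exact: mem_J_ideal.
have aE : a = cmul b w by rewrite bE -cmulA// uwE ua cmul1.
apply: Omega_ext => e; have Je := set_mem (valP e).
apply/idP/idP => /principalE h; apply/principalE.
  by rewrite bE; exact: J_rmul.
by rewrite aE; apply: J_rmul => //; rewrite bE cdom_mul.
Qed.

End characters.

(** * Topological freeness versus fixed points of invertible elements *)

Section fixed_points.
Context {C : lcCategoryType}.
Local Notation G := (transformation_groupoid C).

(** Condition (iii) of the theorem. *)
Definition fixed_point_condition := forall (v u : C) (n : nat) (f : 'I_n -> set C),
  identities C v -> invertibles_at v u ->
  (forall i, J C (f i)) ->
  (forall i, f i `<` ltranslate v setT) ->
  (forall z, (ltranslate v setT `\` \bigcup_i f i) z ->
     ltranslate z (invertibles C) (cmul u z)) ->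
  exists2 x, (ltranslate v setT `\` \bigcup_i f i) x & cmul u x = x.

Lemma fixed_point_topologically_free :
  fixed_point_condition -> topologically_free G.
Proof.
move=> fix_cond; apply/topologically_freeP => gamma U [og dg _] gI oU US.
rewrite -subset0 => x Ux; have [_ [g [[gx _] gg]]] := US x Ux.
have [s [y E]] := germP g; subst g.
pose V : set (Omega C) :=
  (@gunit C @^-1` U) `&` [set chi | exists h : Omega_at s chi, gamma (germ (elt h))].
have oV : open V.
  apply: openI; last exact: germ_open_at.
  exact: (continuousP _).1 (@gunit_continuous C) _ oU.
have Vy : V (val y).
  split; first by rewrite /= -(gsrc_germ y) -germ_cdom gx.
  by exists (set_mem (valP y)); congr gamma: gg; exact: germ_val.
(* Since [cdom] is injective on [gamma], the isotropy germ in [gamma] over chi is [s, chi] itself,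
   so s fixes chi. *)
have fixV chi : V chi -> exists h : Omega_at s chi,
    gamma (germ (elt h)) /\ action (elt h) = chi.
  move=> [Uchi [h gh]]; exists h; split=> //.
  have [_ [g [[gs gt] gg']]] := US _ Uchi.
  have gE : g = germ (elt h).
    apply: dg; [exact: mem_set|exact: mem_set|].
    by rewrite gs germ_cdom gsrc_germ.
  by apply: gunit_inj; rewrite -gt gE germ_ctgt grng_germ.
have [e [r [ye erV]]] := cylinder_base oV Vy.
have [a ea] := principal_dense ye; have [/= ea1 ea2] := (cylinder_principal _ _ _).1 ea.
have fix_principal c d : cylinder e r (principal c) -> val s (c, d) ->
    principal c = principal d.
  move=> ec cd; have [h [_ hE]] := fixV _ (erV _ ec).
  apply: Omega_ext => k; apply/idP/idP => [|/principalE] kc.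
    by apply/principalE; rewrite -(action_principal (chi := elt h) k _ cd)// hE.
  by rewrite -hE; apply/(action_principal (chi := elt h) k _ cd).
have [h [_ _]] := fixV _ (erV _ ea); have [b ab] := (principalE _ _).1 h.
have Is := set_mem (valP s).
have [ba sab] := Il_rmul Is ab.
have [u iu [ua bE]] := (principal_eqP _ _).1 (fix_principal _ _ ea ab).
have du : cdom u = cdom a by rewrite -ba bE cdom_mul.
(* The ideals a^-1 f_i; none contains [cdom a], since [a] avoids every f_i. *)
pose f (i : 'I_(size r)) := val (J_pre (Il_gen a) (tnth (in_tuple r) i)).
have aI : identities C (cdom a) by exact: cdomK.
have cyl z : (ltranslate (cdom a) setT `\` \bigcup_i f i) z ->
    ctgt z = cdom a /\ cylinder e r (principal (cmul a z)).
  rewrite ltranslate_identity// => -[/= za zf]; split=> //.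
  apply/cylinder_principal; split; first exact: J_rmul (set_mem (valP e)) _ _.
  by move=> i fi; apply: zf; exists i => //; exists (cmul a z).
have [||||z zf uz] := fix_cond (cdom a) u (size r) f aI.
- by split.
- by move=> i; exact: set_mem (valP (J_pre _ _)).
- move=> i; split; first by rewrite ltranslate_identity// => z [_ [/= za _] _].
  rewrite ltranslate_identity// => /(_ (cdom a)).
  rewrite /= ctgt_dom => /(_ erefl)[_ [/= _ ->]].
  by rewrite cmul1; exact: ea2.
(* [s] maps az to auz, so auz lies in azC^*; then [a] is cancelled. *)
- move=> z /cyl[za ez].
  have /principal_eqP[w iw [wz E]] := fix_principal _ _ ez (sab _ za).
  rewrite cdom_mul// in wz; exists w => //; split=> //.
  apply: (@cmulI _ a); rewrite ?ctgt_mul ?du//.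
  by rewrite cmulA ?du// -bE E cmulA.
have [za ez] := cyl z zf; have [k [gk _]] := fixV _ (erV _ ez).
have saz : val s (cmul a z, cmul a z).
  by have := sab _ za; rewrite bE -cmulA ?uz// du.
apply: (gI _ gk); rewrite /identities /= germ_cdom gsrc_germ; apply/esym/gunit_eqP.
split=> //; exists (J_ideal (cmul a z)); first by apply/principalE; exact: mem_J_ideal.
move=> ?; rewrite J_idealE => -[c _ [cz ->]].
by have [_ h2] := Il_rmul Is saz; exact: h2.
Qed.

Lemma topologically_free_fixed_point :
  topologically_free (subgroupoid_type (invertible_subgroupoid C)) ->
  fixed_point_condition.
Proof.
move=> /topologically_freeP free v u n f vI [iu tu du] Jf fv uz.
apply: contrapT => nfix; pose s := Il_gen u.
pose r : seq (J C) := [seq elt (Jf i) | i <- enum 'I_n].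
have rP (chi : Omega C) : all (fun k => ~~ val chi k) r <->
    forall i, ~ val chi (elt (Jf i)).
  rewrite all_map; split=> [/allP h i|h]; first exact/negP/h/mem_enum.
  by apply/allP => i _; exact/negP/h.
have rK x : val (J_dom s) x -> all (fun k => ~~ val (principal x) k) r ->
    (ltranslate v setT `\` \bigcup_i f i) x.
  move=> [y [xu _]] /rP rx; split; first by rewrite ltranslate_identity//= [LHS]xu.
  by move=> [i _ fx]; apply: (rx i); exact/principalE.
(* [J_dom s] is vC because [cdom u] is [v]. *)
pose K := cylinder (J_dom s) r.
have sK x : val (J_dom s) x -> val s (x, cmul u x) by move=> [y []].
have uK x : K (principal x) -> principal x = principal (cmul u x).
  by move=> /andP[/principalE xs rx]; apply/principal_eqP/uz/rK.
(* For principal characters this is [uK]. A disagreement at [e] would be shared by all characters of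
   a non-empty cylinder inside [K], hence by a principal one. *)
have fixK (x : Omega_at s) : K (val x) -> action x = val x.
  move=> /andP[xs xr]; apply: Omega_ext => e.
  rewrite -[val (action x) e]/(val (val x) (J_pre s e)).
  apply/idP/idP => xe; apply: contraT => nxe.
    have : cylinder (J_cap (J_dom s) (J_pre s e)) (e :: r) (val x).
      by rewrite cylinder_cap /= xs xe nxe.
    move=> /principal_dense[z]; rewrite cylinder_cap.
    move=> /andP[/andP[zs /principalE[y sy ey]] /andP[/negP ze zr]].
    exfalso; apply: ze; rewrite (uK z); last exact/andP.
    by apply/principalE; rewrite (Il_fun (sK _ ((principalE _ _).1 zs)) sy).
  have : cylinder (J_cap (J_dom s) e) (J_pre s e :: r) (val x).
    by rewrite cylinder_cap /= xs xe nxe.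
  move=> /principal_dense[z]; rewrite cylinder_cap.
  move=> /andP[/andP[zs ze] /andP[/negP nze zr]].
  exfalso; apply: nze; apply/principalE; exists (cmul u z).
    by apply: sK; exact/principalE.
  by apply/principalE; rewrite -uK//; apply/andP.
(* A unit germ would make [u] the identity on some [e] with value 1; density gives a point of [e] in
   vC outside the f_i, which [u] would fix. *)
have unitK (x : Omega_at s) chi : K (val x) -> germ x <> gunit chi.
  move=> /andP[xs xr] /gunit_eqP[<- [e xe h]].
  have : cylinder (J_cap (J_dom s) e) r (val x) by rewrite cylinder_cap xs xe.
  move=> /principal_dense[z]; rewrite cylinder_cap.
  move=> /andP[/andP[/principalE zs /principalE ze] zr].
  by apply: nfix; exists z; [exact: rK|exact: Il_fun (sK _ zs) (h _ ze)].
pose S := subgroupoid_type (invertible_subgroupoid C).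
pose gammaG := [set g : G | exists2 x : Omega_at s, K (val x) & g = germ x].
pose gamma : set S := [set g | gammaG (val g)].
pose U : set S := [set y | (@gunit C @` K) (val y)].
have Ks chi : K chi -> Omega_at s chi by move=> /andP[].
have germK chi (Kc : K chi) : osg_set (invertible_subgroupoid C) (germ (elt (Ks _ Kc))).
  by exists u; [split=> //; rewrite tu|exists (elt (Ks _ Kc))].
(* [K] is non-empty: an f_i containing [v] would contain all of vC. *)
have Kv : K (principal v).
  have vv : ctgt v = v by rewrite -vI ctgt_dom.
  apply/andP; split.
    by apply/principalE; exists (cmul u v); split; rewrite /= ?vv.
  apply/rP => i /principalE /= fi; have [_] := fv i; apply => z.
  rewrite ltranslate_identity//= => zv.
  by rewrite -[z]cmul1l zv; apply: J_rmul => //; rewrite vI.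
(* The unit over chi_v belongs to [U], so emptiness of [U] is absurd. *)
suff U0 : U = set0.
  have Hv := osg_dom (germK _ Kv).
  have : U (osg_elt Hv); last by rewrite U0.
  by exists (principal v) => //=; rewrite germ_cdom gsrc_germ.
apply: (free gamma U).
- split.
  + by exists gammaG => //; apply: germ_image_open; exact: cylinder_open.
  + move=> g h /set_mem[x Kx gE] /set_mem[y Ky hE] /(congr1 val) /= E.
    apply: val_inj; rewrite gE hE; apply: germ_val; apply: gunit_inj.
    by move: E; rewrite gE hE !germ_cdom !gsrc_germ.
  (* The range map is injective on [gamma] because it coincides there with the source map. *)
  + move=> g h /set_mem[x Kx gE] /set_mem[y Ky hE] /(congr1 val) /= E.
    apply: val_inj; rewrite gE hE; apply: germ_val; apply: gunit_inj.
    by move: E; rewrite gE hE !germ_ctgt !grng_germ !fixK.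
- move=> g [x Kx gE] /(congr1 val) /= gI; apply: (unitK _ (gsrc (val g)) Kx).
  by rewrite -gE -[LHS]gI germ_cdom.
- exists (@gunit C @` K) => //; apply: gunit_open; exact: cylinder_open.
- move=> y [chi Kc yE]; split.
    by apply: val_inj; rewrite /= -yE germ_cdom gsrc_unit.
  exists (osg_elt (germK _ Kc)); split; last by exists (elt (Ks _ Kc)).
  split; apply: val_inj; rewrite /= -yE.
    by rewrite germ_cdom gsrc_germ.
  by rewrite germ_ctgt grng_germ fixK.
Qed.

End fixed_points.

Theorem theorem4p4 (C : lcCategoryType) :
  (topologically_free (transformation_groupoid C) <->
   topologically_free (subgroupoid_type (invertible_subgroupoid C))) /\
  (topologically_free (subgroupoid_type (invertible_subgroupoid C)) <->
   (forall (v u : C) (n : nat) (f : 'I_n -> set C),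
      identities C v -> invertibles_at v u ->
      (forall i, J C (f i)) ->
      (forall i, f i `<` ltranslate v setT) ->
      (forall z, (ltranslate v setT `\` \bigcup_i f i) z ->
         ltranslate z (invertibles C) (cmul u z)) ->
      exists2 x, (ltranslate v setT `\` \bigcup_i f i) x & cmul u x = x)).
Proof.
have h12 := @topologically_free_open_subgroupoid _ (invertible_subgroupoid C).
have h23 := @topologically_free_fixed_point C.
have h31 := @fixed_point_topologically_free C.
by split; split=> // h; [exact/h31/h23|exact/h12/h31].
Qed.
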